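(* Let $L_1$ and $L_2$ be oriented Legendrian knots in $\mathbb{R}^3$ with the same classical invariants, i.e. $\operatorname{tb}(L_1)=\operatorname{tb}(L_2)$ and $\operatorname{rot}(L_1)=\operatorname{rot}(L_2)$. Let $X$ be a set, $\sigma$ a permutation of $X$, $X_\sigma$ the corresponding permutation rack, and $(u_l,u_r)$ any 4-Legendrian structure on $X_\sigma$. Then $R=(X_\sigma,u_l,u_r)$ does not distinguish $L_1$ from $L_2$: there is a bijection between the set $\operatorname{Hom}(F(L_1),R)$ of colorings of $L_1$ by $R$ and the set $\operatorname{Hom}(F(L_2),R)$ of colorings of $L_2$ by $R$.
   Context: Racks. A rack $(X,\triangleright)$ is a set $X$ with a binary operation such that for every $y\in X$ the map $\beta_y\colon x\mapsto x\triangleright y$ is a bijection (write $x\triangleright^{-1}y=\beta_y^{-1}(x)$) and $(x\triangleright y)\triangleright z=(x\triangleright z)\triangleright(y\triangleright z)$ for all $x,y,z$. A rack homomorphism is a map preserving $\triangleright$; $\operatorname{Aut}(X)$ is the group of bijective rack homomorphisms $X\to X$; $\operatorname{Inn}(X)=\langle\beta_x\mid x\in X\rangle\le\operatorname{Aut}(X)$. The kink map is $\pi\colon X\to X$, $\pi(x)=x\triangleright x$; it is a rack automorphism. For a set $X$ and a permutation $\sigma$ of $X$, the permutation rack $X_\sigma$ is $X$ with $x\triangleright y=\sigma(x)$. Here $\pi=\sigma$. 4-Legendrian racks. Let $U_X=C_{\operatorname{Aut}(X)}(\operatorname{Inn}(X))$ (centralizer). A 4-Legendrian structure on $(X,\triangleright)$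 is a pair $(u_l,u_r)\in U_X\times U_X$, and then $(X,\triangleright,u_l,u_r)$ is a 4-Legendrian rack. (For $X_\sigma$ this means precisely that $u_l,u_r$ are permutations of $X$ commuting with $\sigma$.) One sets $d_l=u_r^{-1}\pi^{-1}$ and $d_r=u_l^{-1}\pi^{-1}$. A 4-Legendrian rack homomorphism $(X,\triangleright,u_l,u_r)\to(Y,\triangleright,v_l,v_r)$ is a rack homomorphism $\varphi$ with $\varphi u_l=v_l\varphi$ and $\varphi u_r=v_r\varphi$. 4-Legendrian racks form an algebraic theory with operations $\triangleright^{\pm1},u_l^{\pm1},u_r^{\pm1}$, so free 4-Legendrian racks and quotients by generated congruences exist. Legendrian knots. A Legendrian knot is a smooth knot in $\mathbb{R}^3$ everywhere tangent to the plane field $\ker(dz-y\,dx)$; they are considered oriented and up to Legendrian isotopy. The front projection is the projection to the $xz$-plane viewed from the negative $y$-direction (taken generic): it has left and right cusps instead of vertical tangencies, and at each crossing the overstrand is the strand of more negative slope. For an oriented front of $L$, let $w(L)$ be its writhe, and $U$ and $D$ the numbers of cusps traversed upward and downward. Then $\operatorname{tb}(L)=w(L)-\frac12(D+U)$ and $\operatorname{rot}(L)=\frac12(D-U)$; these two integers are the classical invariants of $L$. Fundamental 4-Legendrian rack. Fix an oriented front of $L$, cut it at the undercrossings into arcs $x_1,\dots,x_n$ (an arc may pass through cusps). $F(L)$ is the quotient of the free 4-Legendrian rack on $x_1,\dots,x_n$ by the congruence generated by one relation per crossing, as follows. Traverse the knot along its orientation; the label at the start of the arc $x_i$ is $x_i$,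 and each time a cusp is passed one applies $u_l,u_r,d_l$ or $d_r$ to the current label, where $u$ (resp. $d$) is used if the cusp is traversed upward (resp. downward) and $l$ (resp. $r$) if it is a left (resp. right) cusp. If $a$ is the label at the end of the incoming understrand at a crossing, $y$ is the arc generator of the overstrand, and $x_j$ is the arc beginning after the undercrossing, the relation is $x_j=a\triangleright^{\epsilon}y$, where $\epsilon=\pm1$ is the sign of the crossing. If the front has no crossings, take one generator $x$ (starting at any point that is not a cusp) and the single relation $x=a$, where $a$ is the label obtained after one full traversal. The isomorphism class of $F(L)$ is an invariant of $L$. A coloring of $L$ by a 4-Legendrian rack $R$ is a 4-Legendrian rack homomorphism $F(L)\to R$; the set of colorings is $\operatorname{Hom}(F(L),R)$. *)

(* Defs.v *)
From HB Require Import structures.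
From mathcomp Require Import all_boot all_order all_algebra.
From mathcomp Require Import generic_quotient finmap.
From mathcomp Require Import all_classical all_reals all_analysis.

Set Implicit Arguments.
Unset Strict Implicit.
Unset Printing Implicit Defensive.

Import Order.TTheory GRing.Theory Num.Theory.
Import numFieldNormedType.Exports.

Local Open Scope quotient_scope.
Local Open Scope classical_set_scope.
Local Open Scope ring_scope.

(** * Racks and 4-Legendrian racks *)

Record permutation (X : Type) := Permutation {
  pfun :> X -> X;
  pinv : X -> X;
  pfunK : cancel pfun pinv;
  pinvK : cancel pinv pfun }.

(* [rop x y] is x |> y; [ropV x y] is x |>^-1 y, the inverse of the bijection
   beta_y = rop^~ y applied to x. *)
Record rack := Rack {
  rack_sort :> Type;
  rop : rack_sort -> rack_sort -> rack_sort;
  ropV : rack_sort -> rack_sort -> rack_sort;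
  ropK : forall y, cancel (rop^~ y) (ropV^~ y);
  ropVK : forall y, cancel (ropV^~ y) (rop^~ y);
  ropD : forall x y z, rop (rop x y) z = rop (rop x z) (rop y z) }.

Definition kink (X : rack) (x : X) : X := rop x x.
Definition kinkV (X : rack) (x : X) : X := ropV x x.

Lemma kinkVK (X : rack) : cancel (@kinkV X) (@kink X).
Proof.
move=> x; rewrite /kink /kinkV; apply: (can_inj (ropK x)) => /=.
by rewrite ropD (ropVK x x).
Qed.

Lemma kinkK (X : rack) : cancel (@kink X) (@kinkV X).
Proof.
move=> x; rewrite /kink /kinkV; apply: (can_inj (ropK (rop x x))) => /=.
rewrite (ropVK (rop x x) (rop x x)).
by have := ropD (ropV x x) x x; rewrite (ropVK x x).
Qed.

Definition rack_morphism (X Y : rack) (f : X -> Y) : Prop :=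
  forall x y, f (rop x y) = rop (f x) (f y).

Inductive Inn (X : rack) : (X -> X) -> Prop :=
| Inn_beta (y : X) : Inn (fun x : X => rop x y)
| Inn_id : Inn id
| Inn_comp f g : Inn f -> Inn g -> Inn (f \o g)
| Inn_inv f g : Inn f -> cancel f g -> cancel g f -> Inn g.

(* U_X, the centralizer of Inn(X) in Aut(X). *)
Definition in_U (X : rack) (u : permutation X) : Prop :=
  rack_morphism u /\ forall g, Inn g -> u \o g =1 g \o u.

Record leg4_structure (X : rack) := Leg4Structure {
  str_l : permutation X;
  str_r : permutation X;
  str_lU : in_U str_l;
  str_rU : in_U str_r }.

Record leg4_rack := Leg4Rack {
  leg4_sort :> rack;
  leg4_str : leg4_structure leg4_sort }.

Definition ul (A : leg4_rack) : permutation A := str_l (leg4_str A).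
Definition ur (A : leg4_rack) : permutation A := str_r (leg4_str A).

Record leg4_hom (A B : leg4_rack) := Leg4Hom {
  leg4_fun :> A -> B;
  leg4_homM : rack_morphism leg4_fun;
  leg4_hom_ul : forall x, leg4_fun (ul A x) = ul B (leg4_fun x);
  leg4_hom_ur : forall x, leg4_fun (ur A x) = ur B (leg4_fun x) }.

Definition perm_rack (X : Type) (s : permutation X) : rack :=
  @Rack X (fun x _ => s x) (fun x _ => pinv s x)
    (fun _ => @pfunK X s) (fun _ => @pinvK X s) (fun _ _ _ => erefl).

(** * 4-Legendrian racks presented by generators and relations *)

Inductive leg4_term (G : Type) :=
| TGen of G
| TOp of leg4_term G & leg4_term G
| TOpV of leg4_term G & leg4_term G
| TUl of leg4_term G
| TUlV of leg4_term G
| TUr of leg4_term G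
| TUrV of leg4_term G.

HB.instance Definition _ (G : Type) := gen_eqMixin (leg4_term G).
HB.instance Definition _ (G : Type) := gen_choiceMixin (leg4_term G).

(* The congruence on terms generated by the identities of 4-Legendrian racks
   together with the relations [r].  Given the congruence rules, an operation
   [u] of the theory lies in U_X iff it is invertible, preserves |> and commutes
   with every beta_y. *)
Inductive leg4_cong (G : Type) (r : leg4_term G -> leg4_term G -> Prop) :
    leg4_term G -> leg4_term G -> Prop :=
| Cong_rel a b : r a b -> leg4_cong r a b
| Cong_refl a : leg4_cong r a a
| Cong_sym a b : leg4_cong r a b -> leg4_cong r b a
| Cong_trans a b c : leg4_cong r a b -> leg4_cong r b c -> leg4_cong r a c
| Cong_op a a' b b' : leg4_cong r a a' -> leg4_cong r b b' ->
    leg4_cong r (TOp a b) (TOp a' b')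
| Cong_opV a a' b b' : leg4_cong r a a' -> leg4_cong r b b' ->
    leg4_cong r (TOpV a b) (TOpV a' b')
| Cong_ul a a' : leg4_cong r a a' -> leg4_cong r (TUl a) (TUl a')
| Cong_ulV a a' : leg4_cong r a a' -> leg4_cong r (TUlV a) (TUlV a')
| Cong_ur a a' : leg4_cong r a a' -> leg4_cong r (TUr a) (TUr a')
| Cong_urV a a' : leg4_cong r a a' -> leg4_cong r (TUrV a) (TUrV a')
| Cong_opK a b : leg4_cong r (TOpV (TOp a b) b) a
| Cong_opVK a b : leg4_cong r (TOp (TOpV a b) b) a
| Cong_opD a b c : leg4_cong r (TOp (TOp a b) c) (TOp (TOp a c) (TOp b c))
| Cong_ulK a : leg4_cong r (TUlV (TUl a)) a
| Cong_ulVK a : leg4_cong r (TUl (TUlV a)) a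
| Cong_urK a : leg4_cong r (TUrV (TUr a)) a
| Cong_urVK a : leg4_cong r (TUr (TUrV a)) a
| Cong_ulM a b : leg4_cong r (TUl (TOp a b)) (TOp (TUl a) (TUl b))
| Cong_ulC a b : leg4_cong r (TUl (TOp a b)) (TOp (TUl a) b)
| Cong_urM a b : leg4_cong r (TUr (TOp a b)) (TOp (TUr a) (TUr b))
| Cong_urC a b : leg4_cong r (TUr (TOp a b)) (TOp (TUr a) b).

Lemma in_U_beta (X : rack) (u : permutation X) :
  rack_morphism u -> (forall x y, u (rop x y) = rop (u x) y) -> in_U u.
Proof.
move=> uM uC; split=> // g; elim=> {g}.
- by move=> y x /=; apply: uC.
- by [].
- move=> f g _ IHf _ IHg x.
  by have /= -> := IHf (g x); have /= -> := IHg x.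
- move=> f g _ IHf fK gK x /=.
  by apply: (can_inj fK); have /= <- := IHf (g x); rewrite !gK.
Qed.

Section Presentation.
Variables (G : Type) (r : leg4_term G -> leg4_term G -> Prop).

Let cong_rel : rel (leg4_term G) := fun a b => `[< leg4_cong r a b >].

Fact cong_relP : equiv_class_of cong_rel.
Proof.
split=> [a|a b|b a c].
- exact/asboolP/Cong_refl.
- by apply/asboolP/asboolP; apply: Cong_sym.
- by move=> /asboolP ab /asboolP bc; apply/asboolP; apply: Cong_trans ab bc.
Qed.

Definition leg4_equiv : equiv_rel (leg4_term G) := EquivRelPack cong_relP.

Definition pres_sort : Type := {eq_quot leg4_equiv}.

Let cls (a : leg4_term G) : pres_sort := \pi_({eq_quot leg4_equiv})%qT a.
Let rp (x : pres_sort) : leg4_term G := repr (x : {eq_quot leg4_equiv}).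

Let clsE a b : leg4_cong r a b -> cls a = cls b.
Proof. by move=> h; apply/eqmodP/asboolP. Qed.

Let rpK x : cls (rp x) = x. Proof. exact: reprK. Qed.

Let rpP a : leg4_cong r (rp (cls a)) a.
Proof. by apply/asboolP/(@eqmodP _ leg4_equiv); rewrite reprK. Qed.

Let qW (P : pres_sort -> Prop) : (forall a, P (cls a)) -> forall x, P x.
Proof. by move=> h x; rewrite -[x]rpK. Qed.

Definition pres_op (x y : pres_sort) : pres_sort := cls (TOp (rp x) (rp y)).
Definition pres_opV (x y : pres_sort) : pres_sort := cls (TOpV (rp x) (rp y)).
Definition pres_ul (x : pres_sort) : pres_sort := cls (TUl (rp x)).
Definition pres_ulV (x : pres_sort) : pres_sort := cls (TUlV (rp x)).
Definition pres_ur (x : pres_sort) : pres_sort := cls (TUr (rp x)).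
Definition pres_urV (x : pres_sort) : pres_sort := cls (TUrV (rp x)).

Lemma pres_opE a b : pres_op (cls a) (cls b) = cls (TOp a b).
Proof. by apply/clsE/Cong_op; apply: rpP. Qed.
Lemma pres_opVE a b : pres_opV (cls a) (cls b) = cls (TOpV a b).
Proof. by apply/clsE/Cong_opV; apply: rpP. Qed.
Lemma pres_ulE a : pres_ul (cls a) = cls (TUl a).
Proof. by apply/clsE/Cong_ul; apply: rpP. Qed.
Lemma pres_ulVE a : pres_ulV (cls a) = cls (TUlV a).
Proof. by apply/clsE/Cong_ulV; apply: rpP. Qed.
Lemma pres_urE a : pres_ur (cls a) = cls (TUr a).
Proof. by apply/clsE/Cong_ur; apply: rpP. Qed.
Lemma pres_urVE a : pres_urV (cls a) = cls (TUrV a).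
Proof. by apply/clsE/Cong_urV; apply: rpP. Qed.

Fact pres_opK y : cancel (pres_op^~ y) (pres_opV^~ y).
Proof.
elim/qW: y => b; elim/qW=> a; rewrite pres_opE pres_opVE.
exact/clsE/Cong_opK.
Qed.
Fact pres_opVK y : cancel (pres_opV^~ y) (pres_op^~ y).
Proof.
elim/qW: y => b; elim/qW=> a; rewrite pres_opVE pres_opE.
exact/clsE/Cong_opVK.
Qed.
Fact pres_opD x y z :
  pres_op (pres_op x y) z = pres_op (pres_op x z) (pres_op y z).
Proof.
elim/qW: x => a; elim/qW: y => b; elim/qW: z => c.
by rewrite !pres_opE; apply/clsE/Cong_opD.
Qed.

Definition pres_rack : rack := Rack pres_opK pres_opVK pres_opD.

Fact pres_ulK : cancel pres_ul pres_ulV.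
Proof. by elim/qW=> a; rewrite pres_ulE pres_ulVE; apply/clsE/Cong_ulK. Qed.
Fact pres_ulVK : cancel pres_ulV pres_ul.
Proof. by elim/qW=> a; rewrite pres_ulVE pres_ulE; apply/clsE/Cong_ulVK. Qed.
Fact pres_urK : cancel pres_ur pres_urV.
Proof. by elim/qW=> a; rewrite pres_urE pres_urVE; apply/clsE/Cong_urK. Qed.
Fact pres_urVK : cancel pres_urV pres_ur.
Proof. by elim/qW=> a; rewrite pres_urVE pres_urE; apply/clsE/Cong_urVK. Qed.

Definition pres_ulp : permutation pres_rack := Permutation pres_ulK pres_ulVK.
Definition pres_urp : permutation pres_rack := Permutation pres_urK pres_urVK.

Fact pres_ulU : in_U pres_ulp.
Proof.
apply: in_U_beta; elim/qW=> a; elim/qW=> b.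
  change (pres_ul (pres_op (cls a) (cls b)) =
          pres_op (pres_ul (cls a)) (pres_ul (cls b))).
  by rewrite !(pres_opE, pres_ulE); apply/clsE/Cong_ulM.
change (pres_ul (pres_op (cls a) (cls b)) = pres_op (pres_ul (cls a)) (cls b)).
by rewrite !(pres_opE, pres_ulE); apply/clsE/Cong_ulC.
Qed.
Fact pres_urU : in_U pres_urp.
Proof.
apply: in_U_beta; elim/qW=> a; elim/qW=> b.
  change (pres_ur (pres_op (cls a) (cls b)) =
          pres_op (pres_ur (cls a)) (pres_ur (cls b))).
  by rewrite !(pres_opE, pres_urE); apply/clsE/Cong_urM.
change (pres_ur (pres_op (cls a) (cls b)) = pres_op (pres_ur (cls a)) (cls b)).
by rewrite !(pres_opE, pres_urE); apply/clsE/Cong_urC.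
Qed.

Definition presented : leg4_rack := Leg4Rack (Leg4Structure pres_ulU pres_urU).

End Presentation.

(** * Legendrian knots *)

(* [iter_derive [:: v_1; ..; v_k] f] is D_(v_1) .. D_(v_k) f. *)
Fixpoint iter_derive (R : realType) (V : normedModType R) (vs : seq V)
    (f : V -> R) : V -> R :=
  if vs is v :: vs' then 'D_v (iter_derive vs' f) else f.

Definition smooth (R : realType) (V : normedModType R) (f : V -> R) : Prop :=
  forall (vs : seq V) (x : V), differentiable (iter_derive vs f) x.

Definition in_period (R : realType) (t : R) : Prop := 0 <= t < 1.

(* Oriented Legendrian knots are parametrized by the circle R/Z, compatibly with
   the orientation. *)
Record legendrian_knot (R : realType) := LegendrianKnot {
  kx : R -> R;
  ky : R -> R;
  kz : R -> R;
  kx_smooth : smooth kx;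
  ky_smooth : smooth ky;
  kz_smooth : smooth kz;
  kx_periodic : forall t, kx (t + 1) = kx t;
  ky_periodic : forall t, ky (t + 1) = ky t;
  kz_periodic : forall t, kz (t + 1) = kz t;
  k_immersed : forall t,
    ~ [/\ derive1 kx t = 0, derive1 ky t = 0 & derive1 kz t = 0];
  k_injective : forall s t, in_period s -> in_period t ->
    kx s = kx t -> ky s = ky t -> kz s = kz t -> s = t;
  k_tangent : forall t, derive1 kz t = ky t * derive1 kx t }.

(* The deformation parameter ranges over R rather than [0, 1]; precomposing with
   a smooth step function extends an isotopy over [0, 1] in this way. *)
Definition legendrian_isotopic (R : realType) (L L' : legendrian_knot R) : Prop :=
  exists H : R -> legendrian_knot R,
    [/\ H 0 = L, H 1 = L',
      smooth (fun p : R * R => kx (H p.1) p.2),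
      smooth (fun p : R * R => ky (H p.1) p.2) &
      smooth (fun p : R * R => kz (H p.1) p.2)].

Section Front.
Variables (R : realType) (K : legendrian_knot R).

Definition is_cusp (t : R) : Prop := in_period t /\ derive1 (kx K) t = 0.

Definition double_point (s t : R) : Prop :=
  [/\ in_period s, in_period t, s != t, kx K s = kx K t & kz K s = kz K t].

(* A crossing is recorded as (parameter of the overstrand, parameter of the
   understrand).  The slope dz/dx of a strand is its y-coordinate. *)
Definition is_crossing (p : R * R) : Prop :=
  double_point p.1 p.2 /\ ky K p.1 < ky K p.2.

(* Double points away from cusps are automatically transverse: the slopes are
   the y-coordinates, which differ since K is embedded. *)
Record generic_front : Prop := GenericFront {
  cusps_finite : finite_set [set t | is_cusp t];
  crossings_finite : finite_set [set p | is_crossing p];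
  cusps_simple : forall t, is_cusp t -> derive1n 2 (kx K) t != 0;
  crossings_off_cusps : forall s t, double_point s t -> ~ is_cusp s;
  no_triple_points : forall s t t',
    double_point s t -> double_point s t' -> t = t' }.

Definition cusps : seq R := sort <=%R (enum_fset (fset_set [set t | is_cusp t])).

(* In the order in which the understrands are met. *)
Definition crossings : seq (R * R) :=
  sort (fun p q : R * R => p.2 <= q.2)
    (enum_fset (fset_set [set p | is_crossing p])).

(* x has a local minimum at a left cusp and a local maximum at a right cusp. *)
Definition left_cusp (t : R) : bool := 0 < derive1n 2 (kx K) t.

(* The incoming branch lies below the outgoing one.  The sign of z' would not
   do, as the tangent line at a cusp need not be horizontal. *)
Definition up_cusp (t : R) : bool :=
  `[< exists2 e : R, 0 < e & forall s s' : R,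
        t - e < s < t -> t < s' < t + e -> kx K s = kx K s' ->
        kz K s < kz K s' >].

(* The sign of (tangent of overstrand) x (tangent of understrand); seen from the
   negative y-direction, x points right and z points up. *)
Definition positive_crossing (p : R * R) : bool :=
  0 < derive1 (kx K) p.1 * derive1 (kz K) p.2
      - derive1 (kz K) p.1 * derive1 (kx K) p.2.

Definition crossing_sign (p : R * R) : int :=
  if positive_crossing p then 1 else -1.

Definition writhe : int := \sum_(p <- crossings) crossing_sign p.
Definition nb_up : nat := count up_cusp cusps.
Definition nb_down : nat := count (predC up_cusp) cusps.

Definition thurston_bennequin : rat := writhe%:~R - (nb_down + nb_up)%:R / 2.
Definition rotation_number : rat := (nb_down%:R - nb_up%:R) / 2.

(** ** The fundamental 4-Legendrian rack *)

Definition nb_crossings : nat := size crossings.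

(* Arc i starts at the i-th undercrossing; a front without crossings has the
   single generator 0. *)
Definition front_arc : Type := 'I_nb_crossings.-1.+1.

Definition arc_gen (i : nat) : leg4_term front_arc := TGen (inord i).

Definition under_param (i : nat) : R := (nth (0, 0) crossings i).2.

(* The cusps on arc i, in order; the last arc runs through the base point of the
   parametrization. *)
Definition cusps_on_arc (i : nat) : seq R :=
  if (i.+1 < nb_crossings)%N then
    [seq t <- cusps | under_param i < t < under_param i.+1]
  else [seq t <- cusps | under_param i < t]
         ++ [seq t <- cusps | t < under_param 0].

(* The index of the arc containing parameter t, namely the arc starting at the
   last undercrossing before t, cyclically. *)
Definition arc_of (t : R) : nat :=
  ((count (fun p : R * R => p.2 < t)%R crossings + nb_crossings.-1)
     %% nb_crossings)%N.

(* d_l = u_r^-1 pi^-1 and d_r = u_l^-1 pi^-1, with pi^-1 x = x |>^-1 x as in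
   [kinkV]. *)
Definition pass_cusp (a : leg4_term front_arc) (t : R) : leg4_term front_arc :=
  match up_cusp t, left_cusp t with
  | true, true => TUl a
  | true, false => TUr a
  | false, true => TUrV (TOpV a a)
  | false, false => TUlV (TOpV a a)
  end.

Definition pass_cusps (a : leg4_term front_arc) (ts : seq R) : leg4_term front_arc :=
  foldl pass_cusp a ts.

Definition pass_under (a : leg4_term front_arc) (p : R * R) : leg4_term front_arc :=
  let y := arc_gen (arc_of p.1) in
  if positive_crossing p then TOp a y else TOpV a y.

(* Arc i ends at crossing number i + 1 (mod nb_crossings), where the next arc
   begins.  Without crossings, the traversal starts just before parameter 0 if
   there is a cusp at 0, and at 0 otherwise. *)
Definition front_rel (a b : leg4_term front_arc) : Prop :=
  if nb_crossings == 0%N then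
    a = arc_gen 0 /\ b = pass_cusps (arc_gen 0) cusps
  else exists2 i : nat, (i < nb_crossings)%N &
    let j := (i.+1 %% nb_crossings)%N in
    a = arc_gen j /\
    b = pass_under (pass_cusps (arc_gen i) (cusps_on_arc i))
          (nth (0, 0) crossings j).

Definition fundamental_rack : leg4_rack := presented front_rel.

End Front.

(* The invariants of a Legendrian knot are computed from a generic front within
   its Legendrian isotopy class. *)
Definition front_of (R : realType) (L K : legendrian_knot R) : Prop :=
  legendrian_isotopic L K /\ generic_front K.

(* Main.v *)
Require Import Defs.
From mathcomp Require Import all_boot all_order all_algebra.
From mathcomp Require Import generic_quotient finmap ring lra zify.
From mathcomp Require Import all_classical all_reals all_analysis.

(** Evaluating a coloring at the first arc identifies Hom(F(L), R) with the
    fixed points of the monodromy of one traversal of L, since over a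
    permutation rack an undercrossing acts by sigma^(+-1) whatever the
    overstrand is.  Left and right cusps alternate along a front, because x'
    changes sign at each of its simple zeros.  Reading the cusps in pairs
    (right, left), the four possible pairs act by u_l u_r, sigma^-1, sigma^-1
    and (u_l u_r)^-1 sigma^-2, so although u_l and u_r need not commute the
    monodromy is sigma^(w - D) (u_l u_r)^((U - D) / 2); if the traversal starts
    before a left cusp, u_r u_l replaces u_l u_r.  The exponents are tb - rot
    and - rot, and u_l u_r, u_r u_l are conjugate by u_l or u_r. *)

Set Implicit Arguments.
Unset Strict Implicit.
Unset Printing Implicit Defensive.

Import Order.TTheory GRing.Theory Num.Theory.
Import numFieldNormedType.Exports.
(* [pinv] also names a function of MathComp-Analysis. *)
Import Defs.

Local Open Scope quotient_scope.
Local Open Scope classical_set_scope.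
Local Open Scope ring_scope.

(** * Zeros of a real function *)

(** The difference quotient at [x] tends to a positive limit, so it is positive near [x], and
    [h * f (x + h)] is [h ^+ 2] times it. *)
Lemma simple_zero_sign (R : realType) (f : R -> R) (x : R) :
  derivable f x 1 -> f x = 0 -> 0 < derive1 f x ->
  exists2 d : R, 0 < d & forall h, h != 0 -> `|h| < d -> 0 < h * f (x + h).
Proof.
move=> dfx fx0; rewrite derive1E => dfx_gt0.
have := @cvgr_gt _ _ _ _ _ _ dfx 0 dfx_gt0.
rewrite near_withinE => /(_ _)/nbhs_ballP[d /= d_gt0 dP]; exists d => // h h_neq0 hd.
have /= := dP h; rewrite /ball /= sub0r normrN => /(_ hd h_neq0).
rewrite fx0 subr0 scaler1 /GRing.scale /= addrC => hf.
have -> : h * f (x + h) = h ^+ 2 * (h^-1 * f (x + h)) by field.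
by rewrite mulr_gt0 // exprn_even_gt0.
Qed.

(** If [f] increased through both zeros, it would be positive just after [a] and negative just
    before [b], and the intermediate value theorem would give a zero in between. *)
Lemma consecutive_zeros_not_both_increasing (R : realType) (f : R -> R) (a b : R) :
  a < b -> (forall x, derivable f x 1) -> f a = 0 -> f b = 0 ->
  (forall x, a < x < b -> f x != 0) -> 0 < derive1 f a -> derive1 f b <= 0.
Proof.
move=> ltab df fa0 fb0 fN0 dfa; rewrite leNgt; apply/negP => dfb.
have [d d_gt0 dP] := simple_zero_sign (df a) fa0 dfa.
have [e e_gt0 eP] := simple_zero_sign (df b) fb0 dfb.
(* A third of the minimum keeps [a + k] and [b - k] where the sign of [f] is known, and in this
   order. *)
pose k := Num.min (Num.min d e) (b - a) / 3%:R.
have mgt0 : 0 < Num.min (Num.min d e) (b - a) by rewrite !lt_min d_gt0 e_gt0 subr_gt0.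
have k_gt0 : 0 < k by rewrite divr_gt0.
have mE : Num.min (Num.min d e) (b - a) = 3%:R * k by rewrite /k; field.
have := lexx (Num.min (Num.min d e) (b - a)).
rewrite [X in X <= _]mE !le_min => /andP[/andP[kd ke] kab].
have fa : 0 < f (a + k).
  have := dP k (lt0r_neq0 k_gt0); rewrite gtr0_norm // pmulr_rgt0 //; apply; lra.
have fb : f (b - k) < 0.
  have := eP (- k); rewrite oppr_eq0 (lt0r_neq0 k_gt0) normrN gtr0_norm // mulNr oppr_gt0.
  by rewrite pmulr_rlt0 //; apply => //; lra.
have leab : a + k <= b - k by lra.
have fc : {within `[a + k, b - k], continuous f}.
  by apply: derivable_within_continuous => x _.
have [|c] := @IVT R f _ _ 0 leab fc; first by rewrite ge_min le_max (ltW fa) (ltW fb) orbT.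
rewrite in_itv /= => /andP[ac cb] /eqP; apply/negP/fN0.
by apply/andP; split; lra.
Qed.

(** The preceding lemma is applied to [f] or to [- f], according to the sign of the derivative at
    [a]. *)
Lemma consecutive_zeros_alternate (R : realType) (f : R -> R) (a b : R) :
  a < b -> (forall x, derivable f x 1) -> f a = 0 -> f b = 0 ->
  (forall x, a < x < b -> f x != 0) -> derive1 f a != 0 -> derive1 f b != 0 ->
  (0 < derive1 f a) != (0 < derive1 f b).
Proof.
move=> ltab df fa0 fb0 fN0 dfa dfb.
have [da|da] := ltP 0 (derive1 f a).
  by rewrite ltNge (consecutive_zeros_not_both_increasing ltab df fa0 fb0 fN0 da).
have NdE x : derive1 (- f) x = - derive1 f x by rewrite !derive1E deriveN.
have NfE x : (- f) x = - f x by [].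
have : derive1 (- f) b <= 0.
  apply: (consecutive_zeros_not_both_increasing ltab).
  - by move=> x; apply: derivableN.
  - by rewrite NfE fa0 oppr0.
  - by rewrite NfE fb0 oppr0.
  - by move=> x /fN0; rewrite NfE oppr_eq0.
  - by rewrite NdE oppr_gt0 lt_neqAle dfa.
by rewrite NdE oppr_le0 lt0r dfb => ->.
Qed.

(** Sortedness and completeness of the list leave no zero between neighbours. The endpoint [b]
    stands apart from [s] because it will be the first zero shifted by a period. *)
Lemma zeros_alternate (R : realType) (f : R -> R) (s : seq R) (a b : R) :
  (forall x, derivable f x 1) ->
  (forall x, x \in a :: rcons s b -> f x = 0 /\ derive1 f x != 0) ->
  path <%R a (rcons s b) ->
  (forall x, a < x < b -> f x = 0 -> x \in s) ->
  path (fun x y => (0 < derive1 f x) != (0 < derive1 f y)) a (rcons s b).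
Proof.
move=> df; elim: s a => [|c s IHs] a sP /=.
  rewrite !andbT => ltab zP.
  have [fa dfa] := sP a (mem_head _ _); have [|fb dfb] := sP b; first by rewrite !inE eqxx orbT.
  apply: consecutive_zeros_alternate => // x /zP xs; apply/eqP=> /xs.
  by rewrite in_nil.
move=> /andP[ltac pc] zP; apply/andP; split.
  have [fa dfa] := sP a (mem_head _ _).
  have [|fc dfc] := sP c; first by rewrite !inE eqxx orbT.
  apply: consecutive_zeros_alternate => // x /andP[ax xc]; apply/eqP => fx.
  have ltcb : c < b.
    by move/(order_path_min lt_trans)/allP: pc; apply; rewrite mem_rcons mem_head.
  have := zP x; rewrite ax (lt_trans xc ltcb) => /(_ isT fx).
  rewrite inE (lt_eqF xc) /= => xs.
  move/(order_path_min lt_trans)/allP: pc => /(_ x).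
  by rewrite mem_rcons inE xs orbT ltNge (ltW xc) => /(_ isT).
apply: IHs => //.
- by move=> x xs; apply: sP; rewrite inE xs orbT.
- move=> x /andP[cx xb] fx; have := zP x; rewrite (lt_trans ltac cx) xb.
  by move=> /(_ isT fx); rewrite inE (gt_eqF cx).
Qed.

Lemma derive1_periodic (R : realType) (f : R -> R) (c : R) :
  (forall t, f (t + c) = f t) -> forall t, derive1 f (t + c) = derive1 f t.
Proof.
by move=> fc t; rewrite /derive1; under eq_fun do rewrite addrA !fc.
Qed.

(** * Words of cusps *)

Definition zpow (X : Type) (p : permutation X) (z : int) : X -> X :=
  match z with Posz n => iter n p | Negz n => iter n.+1 (pinv p) end.

Definition perm_comp (X : Type) (p q : permutation X) : permutation X :=
  Permutation (can_comp (pfunK p) (pfunK q)) (can_comp (pinvK q) (pinvK p)).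

Lemma zpowS (X : Type) (p : permutation X) (z : int) (x : X) :
  zpow p (z + 1) x = p (zpow p z x).
Proof.
case: z => [n|[|n]]; first by rewrite -PoszD addn1.
  by rewrite /= pinvK.
have -> : Negz n.+1 + 1 = Negz n by lia.
by rewrite [zpow p (Negz n.+1) x]iterS pinvK.
Qed.

Lemma zpow_pred (X : Type) (p : permutation X) (z : int) (x : X) :
  zpow p (z - 1) x = pinv p (zpow p z x).
Proof. by rewrite -[z in RHS](subrK 1) zpowS pfunK. Qed.

Lemma zpowD (X : Type) (p : permutation X) (y z : int) (x : X) :
  zpow p (y + z) x = zpow p y (zpow p z x).
Proof.
elim: y => [|n IHn|n IHn]; first by rewrite add0r.
- by rewrite -addn1 PoszD addrAC !zpowS IHn.
- by rewrite -addn1 PoszD opprD addrAC !zpow_pred IHn.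
Qed.

(** For negative exponents, injectivity of [q] turns the hypothesis into the same relation between
    the inverses. This serves both for commuting permutations and for conjugating one product of
    [u_l] and [u_r] to the other. *)
Lemma zpow_conj (X : Type) (p q : permutation X) (f : X -> X) :
  (forall x, f (p x) = q (f x)) ->
  forall z x, f (zpow p z x) = zpow q z (f x).
Proof.
move=> fpq z x; elim: z => // n IHn.
- by rewrite -addn1 PoszD !zpowS fpq IHn.
- rewrite -addn1 PoszD opprD !zpow_pred -IHn.
  by apply: (can_inj (pfunK q)); rewrite pinvK -fpq pinvK.
Qed.

Lemma zpow_comm (X : Type) (p q : permutation X) (y z : int) (x : X) :
  (forall x, p (q x) = q (p x)) ->
  zpow p y (zpow q z x) = zpow q z (zpow p y x).
Proof.
by move=> pq; apply: zpow_conj => {}x; apply/esym/(zpow_conj (fun x => esym (pq x))).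
Qed.

(* A cusp is encoded by the pair (upward, left). *)
Definition cusp_op (X : Type) (s a b : permutation X) (x : X) (c : bool * bool) : X :=
  match c with
  | (true, true) => a x
  | (true, false) => b x
  | (false, true) => pinv b (pinv s x)
  | (false, false) => pinv a (pinv s x)
  end.

Definition alternate (c d : bool * bool) : bool := c.2 != d.2.

(** Each cusp acts by a product of [a], [b] and inverses of [a], [b], [s], all commuting with [s].
    This lets the powers of [s] coming from crossings move past later cusps. *)
Lemma cusp_op_conj (X : Type) (s a b : permutation X) :
  (forall x, a (s x) = s (a x)) -> (forall x, b (s x) = s (b x)) ->
  forall w x, foldl (cusp_op s a b) (s x) w = s (foldl (cusp_op s a b) x w).
Proof.
move=> aC bC; have inv (p : permutation X) :
    (forall x, p (s x) = s (p x)) -> forall x, pinv p (s x) = s (pinv p x).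
  by move=> pC x; apply: (can_inj (pfunK p)); rewrite pC !pinvK.
elim=> [|[[] []] w IHw] x //=; rewrite ?aC ?bC //.
  by rewrite pfunK -IHw -inv // pinvK.
by rewrite pfunK -IHw -inv // pinvK.
Qed.

(** Alternation cuts the word into (right, left) pairs. Each pair acts in the asserted form, and the
    exponents add up because [s] commutes with [perm_comp a b]. *)
Lemma cusp_word_right_first (X : Type) (s a b : permutation X) :
  (forall x, a (s x) = s (a x)) -> (forall x, b (s x) = s (b x)) ->
  forall p c, path alternate c p -> c.2 = false -> (last c p).2 = true ->
  exists2 z : int,
    (count fst (c :: p))%:Z - (count (predC fst) (c :: p))%:Z = z *+ 2 &
    forall x, foldl (cusp_op s a b) x (c :: p) =
      zpow s (- (count (predC fst) (c :: p))%:Z) (zpow (perm_comp a b) z x).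
Proof.
move=> aC bC p.
have pC x : perm_comp a b (s x) = s (perm_comp a b x) by rewrite /= bC aC.
have invC (q : permutation X) : (forall x, q (s x) = s (q x)) ->
    forall x, pinv s (q x) = q (pinv s x).
  by move=> qC x; apply: (can_inj (pfunK s)); rewrite -qC !pinvK.
have inv2C (q : permutation X) : (forall x, q (s x) = s (q x)) ->
    forall x, pinv s (pinv q x) = pinv q (pinv s x).
  by move=> qC x; apply: (can_inj (pfunK q)); rewrite -invC // !pinvK.
(* In a mixed pair the downward cusp undoes the upward one and leaves the inverse of [s]; two upward
   cusps give [a] after [b], and two downward cusps its inverse together with the inverse square of
   [s]. *)
have pairP c d : c.2 = false -> d.2 = true -> exists2 z : int,
    (count fst [:: c; d])%:Z - (count (predC fst) [:: c; d])%:Z = z *+ 2 &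
    forall x, cusp_op s a b (cusp_op s a b x c) d =
      zpow s (- (count (predC fst) [:: c; d])%:Z) (zpow (perm_comp a b) z x).
  case: c d => [[] []] [[] []] //= _ _.
  - by exists 1 => //.
  - by exists 0 => // x /=; rewrite invC // pfunK.
  - by exists 0 => // x /=; rewrite pinvK.
  - by exists (-1) => // x /=; rewrite -!inv2C.
(* Induction on the length, since two letters are removed at a time; a single letter cannot be both
   right and left. *)
have [n] := ubnP (size p); elim: n p => // n IHn [|d [|e p]] size_p c.
- by move=> _ /= ->.
- by move=> _ cF dT; have [z] := pairP c d cF dT; exists z.
rewrite [path _ _ _]/= /alternate => /and3P[cd de ep] cF lT.
have dT : d.2 = true by move: cd; rewrite cF; case: d.2.
have eF : e.2 = false by move: de; rewrite dT; case: e.2.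
have [z zE zP] := pairP c d cF dT.
have [|y yE yP] := IHn p _ e ep eF lT; first by move: size_p => /=; lia.
exists (z + y).
  by rewrite mulrnDl -zE -yE /=; lia.
move=> x; rewrite [LHS]/= -[foldl _ _ p]/(foldl (cusp_op s a b) _ (e :: p)) yP zP.
rewrite (zpow_comm _ _ _ pC) -!zpowD; congr (zpow s _ _); last by rewrite addrC.
by move=> /=; lia.
Qed.

(** This symmetry reduces words that begin at a left cusp to words that begin at a right one, at the
    cost of exchanging [a] and [b] in the product. *)
Lemma cusp_op_swap (X : Type) (s a b : permutation X) (w : seq (bool * bool)) (x : X) :
  foldl (cusp_op s b a) x [seq (c.1, ~~ c.2) | c <- w] = foldl (cusp_op s a b) x w.
Proof. by elim: w x => [|[[] []] w IHw] x /=; rewrite ?IHw. Qed.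

(** Cyclic alternation puts the last cusp on the side opposite to the first, so the previous normal
    form applies, after a flip if the first cusp is left. *)
Lemma cusp_word_cyclic (X : Type) (s a b : permutation X) (w : seq (bool * bool)) :
  (forall x, a (s x) = s (a x)) -> (forall x, b (s x) = s (b x)) ->
  path.cycle alternate w ->
  exists2 z : int, (count fst w)%:Z - (count (predC fst) w)%:Z = z *+ 2 &
    (forall x, foldl (cusp_op s a b) x w =
       zpow s (- (count (predC fst) w)%:Z) (zpow (perm_comp a b) z x)) \/
    (forall x, foldl (cusp_op s a b) x w =
       zpow s (- (count (predC fst) w)%:Z) (zpow (perm_comp b a) z x)).
Proof.
move=> aC bC; case: w => [_|c p]; first by exists 0 => //; left.
rewrite [path.cycle _ _]/= rcons_path => /andP[cp pc].
case cT: c.2; last first.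
  have lT : (last c p).2 = true by move: pc; rewrite /alternate cT; case: (_.2).
  by have [z zE zP] := cusp_word_right_first aC bC cp cT lT; exists z => //; left.
pose flip := fun d : bool * bool => (d.1, ~~ d.2).
have cp' : path alternate (flip c) (map flip p).
  rewrite path_map; apply: sub_path cp => d e.
  by rewrite /alternate /=; case: d.2; case: e.2.
have [||z zE zP] := cusp_word_right_first bC aC cp'.
- by rewrite /= cT.
- by rewrite last_map /=; move: pc; rewrite /alternate cT; case: (_.2).
have countE (f : bool -> bool) : count (fun d => f d.1) (flip c :: map flip p) =
    count (fun d => f d.1) (c :: p).
  by rewrite /= count_map.
have uE := countE id; have dE := countE negb.
exists z; first by rewrite -zE; congr (Posz _ - Posz _).
right=> x; rewrite -cusp_op_swap; have := zP x.
by rewrite -[flip c :: _]/(map flip (c :: p)) => ->; congr (zpow s (- Posz _) _).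
Qed.

(** * Homomorphisms out of a presented 4-Legendrian rack *)

Fixpoint term_eval (G : Type) (A : leg4_rack) (v : G -> A) (t : leg4_term G) : A :=
  match t with
  | TGen g => v g
  | TOp a b => rop (term_eval v a) (term_eval v b)
  | TOpV a b => ropV (term_eval v a) (term_eval v b)
  | TUl a => ul A (term_eval v a)
  | TUlV a => pinv (ul A) (term_eval v a)
  | TUr a => ur A (term_eval v a)
  | TUrV a => pinv (ur A) (term_eval v a)
  end.

Lemma in_U_op (X : rack) (u : permutation X) (x y : X) :
  in_U u -> u (rop x y) = rop (u x) y.
Proof. by move=> [_ /(_ _ (Inn_beta y))]; apply. Qed.

(** Soundness, by induction on the derivation: every rule is an identity valid in [A]. *)
Lemma term_eval_cong (G : Type) (r : leg4_term G -> leg4_term G -> Prop)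
    (A : leg4_rack) (v : G -> A) (a b : leg4_term G) :
  (forall a b, r a b -> term_eval v a = term_eval v b) ->
  leg4_cong r a b -> term_eval v a = term_eval v b.
Proof.
have lU : in_U (ul A) := str_lU (leg4_str A).
have rU : in_U (ur A) := str_rU (leg4_str A).
move=> vr; elim=> {a b} //=.
- by move=> a b c _ -> _ ->.
- by move=> a a' b b' _ -> _ ->.
- by move=> a a' b b' _ -> _ ->.
- by move=> a a' _ ->.
- by move=> a a' _ ->.
- by move=> a a' _ ->.
- by move=> a a' _ ->.
- by move=> a b; apply: ropK.
- by move=> a b; apply: ropVK.
- by move=> a b c; apply: ropD.
- by move=> a; apply: pfunK.
- by move=> a; apply: pinvK.
- by move=> a; apply: pfunK.
- by move=> a; apply: pinvK.
- by move=> a b; apply: lU.1.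
- by move=> a b; apply: in_U_op.
- by move=> a b; apply: rU.1.
- by move=> a b; apply: in_U_op.
Qed.

Definition pres_class (G : Type) (r : leg4_term G -> leg4_term G -> Prop)
    (t : leg4_term G) : presented r :=
  \pi_({eq_quot (leg4_equiv r)})%qT t.

Lemma pres_class_cong (G : Type) (r : leg4_term G -> leg4_term G -> Prop)
    (a b : leg4_term G) :
  leg4_cong r a b <-> pres_class r a = pres_class r b.
Proof. by split=> [ab|/eqmodP/asboolP //]; apply/eqmodP/asboolP. Qed.

Lemma pres_classP (G : Type) (r : leg4_term G -> leg4_term G -> Prop)
    (P : presented r -> Prop) :
  (forall t, P (pres_class r t)) -> forall x, P x.
Proof.
move=> Pt x; have := Pt (repr (x : {eq_quot (leg4_equiv r)})).
by rewrite /pres_class reprK.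
Qed.

(** A [leg4_hom] is only asked to respect the positive operations; compatibility with the inverse
    ones follows by cancelling in [A]. *)
Lemma hom_pres_class (G : Type) (r : leg4_term G -> leg4_term G -> Prop)
    (A : leg4_rack) (h : leg4_hom (presented r) A) (t : leg4_term G) :
  h (pres_class r t) = term_eval (fun g => h (pres_class r (TGen g))) t.
Proof.
elim: t => //= [a <- b <-|a <- b <-|a <-|a <-|a <-|a <-].
- by rewrite -leg4_homM; congr (h _); apply/esym/pres_opE.
- apply: (can_inj (ropK (h (pres_class r b)))); rewrite ropVK -leg4_homM.
  by congr (h _); rewrite -[RHS](ropVK (pres_class r b)); congr rop; apply/esym/pres_opVE.
- by rewrite -leg4_hom_ul; congr (h _); apply/esym/pres_ulE.
- apply: (can_inj (pfunK (ul A))); rewrite pinvK -leg4_hom_ul.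
  by congr (h _); rewrite -[RHS](pinvK (ul _)); congr (ul _ _); apply/esym/pres_ulVE.
- by rewrite -leg4_hom_ur; congr (h _); apply/esym/pres_urE.
- apply: (can_inj (pfunK (ur A))); rewrite pinvK -leg4_hom_ur.
  by congr (h _); rewrite -[RHS](pinvK (ur _)); congr (ur _ _); apply/esym/pres_urVE.
Qed.

Lemma leg4_hom_ext (A B : leg4_rack) (h k : leg4_hom A B) : h =1 k -> h = k.
Proof.
case: h => h h1 h2 h3; case: k => k k1 k2 k3 /= /funext hk.
by subst k; congr Leg4Hom; apply: Prop_irrelevance.
Qed.

Lemma presented_hom_ext (G : Type) (r : leg4_term G -> leg4_term G -> Prop)
    (A : leg4_rack) (h k : leg4_hom (presented r) A) :
  (forall g, h (pres_class r (TGen g)) = k (pres_class r (TGen g))) -> h = k.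
Proof.
move=> hk; apply: leg4_hom_ext => x; elim/pres_classP: x => t; rewrite !hom_pres_class.
by congr term_eval; apply/funext.
Qed.

(** The existence half of the universal property of a presentation; uniqueness is
    [presented_hom_ext]. *)
Lemma presented_lift (G : Type) (r : leg4_term G -> leg4_term G -> Prop)
    (A : leg4_rack) (v : G -> A) :
  (forall a b, r a b -> term_eval v a = term_eval v b) ->
  exists h : leg4_hom (presented r) A, forall g, h (pres_class r (TGen g)) = v g.
Proof.
(* Evaluation of a chosen representative; soundness makes the choice immaterial. *)
move=> vr; pose f (x : presented r) := term_eval v (repr (x : {eq_quot (leg4_equiv r)})).
have fE t : f (pres_class r t) = term_eval v t.
  by apply: (term_eval_cong vr); apply/pres_class_cong; rewrite /pres_class reprK.
have fM : rack_morphism f.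
  elim/pres_classP=> a; elim/pres_classP=> b.
  have -> : rop (pres_class r a) (pres_class r b) = pres_class r (TOp a b).
    exact: pres_opE.
  by rewrite !fE.
have fl x : f (ul _ x) = ul A (f x).
  elim/pres_classP: x => a.
  have -> : ul (presented r) (pres_class r a) = pres_class r (TUl a).
    exact: pres_ulE.
  by rewrite !fE.
have fr x : f (ur _ x) = ur A (f x).
  elim/pres_classP: x => a.
  have -> : ur (presented r) (pres_class r a) = pres_class r (TUr a).
    exact: pres_urE.
  by rewrite !fE.
by exists (Leg4Hom fM fl fr) => g; apply: fE.
Qed.

(** Both sets embed into [X], and [phi] and [psi] match their images; preimages are picked by
    choice. *)
Lemma bijection_of_images (A B X : Type) (f : A -> X) (g : B -> X)
    (phi psi : X -> X) :
  injective f -> injective g ->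
  (forall a, exists b, g b = phi (f a)) -> (forall b, exists a, f a = psi (g b)) ->
  (forall a, psi (phi (f a)) = f a) -> (forall b, phi (psi (g b)) = g b) ->
  exists F : A -> B, bijective F.
Proof.
move=> f_inj g_inj fg gf fK gK.
exists (fun a => projT1 (cid (fg a))); exists (fun b => projT1 (cid (gf b))) => [a|b].
  by case: (cid (gf _)) => a' /=; case: (cid (fg a)) => b /= ->; rewrite fK => /f_inj.
by case: (cid (fg _)) => b' /=; case: (cid (gf b)) => a /= ->; rewrite gK => /g_inj.
Qed.

(** * Cusps and crossings of a front *)

(** In a sorted list all elements satisfying [P] precede those satisfying [Q]. This glues the cusps
    of successive arcs. *)
Lemma cat_filter_sorted (d : Order.disp_t) (T : porderType d) (s : seq T)
    (P Q : pred T) :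
  sorted <=%O s -> (forall x y, P x -> Q y -> (x < y)%O) ->
  [seq x <- s | P x] ++ [seq x <- s | Q x] = [seq x <- s | P x || Q x].
Proof.
move=> s_sorted PQ; elim: s s_sorted => //= a s IHs a_s.
have {}IHs := IHs (path_sorted a_s).
have [Pa|Pa] /= := boolP (P a).
  have -> : Q a = false by apply/negP => Qa; have := PQ _ _ Pa Qa; rewrite ltxx.
  by rewrite -IHs.
have [Qa|Qa] //= := boolP (Q a).
have PF : [seq x <- s | P x] = [::].
  apply/eqP; rewrite -[_ == _]negbK -has_filter; apply/hasPn => x xs.
  have := order_path_min le_trans a_s => /allP/(_ x xs) ax.
  by apply/negP => Px; have := PQ _ _ Px Qa; rewrite le_gtF.
by rewrite -IHs PF.
Qed.

Lemma mem_cusps (R : realType) (K : legendrian_knot R) (t : R) :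
  generic_front K -> t \in cusps K <-> is_cusp K t.
Proof.
move=> gK; rewrite /cusps mem_sort.
rewrite -[t \in _]/(t \in fset_set [set t | is_cusp K t]) in_fset_set; last exact: cusps_finite gK.
by rewrite inE.
Qed.

Lemma cusps_sorted (R : realType) (K : legendrian_knot R) : sorted <%R (cusps K).
Proof.
by rewrite lt_sorted_uniq_le sort_uniq fset_uniq sort_sorted //; apply: le_total.
Qed.

Definition cusp_type (R : realType) (K : legendrian_knot R) (t : R) : bool * bool :=
  (up_cusp K t, left_cusp K t).

(** Cusps are the zeros of x' in one period, and the sign of x'' there tells left from right.
    Appending the first cusp shifted by 1 closes the cycle. *)
Lemma cusps_alternate (R : realType) (K : legendrian_knot R) :
  generic_front K ->
  path.cycle alternate (map (cusp_type K) (cusps K)).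
Proof.
move=> gK; have := cusps_sorted K; have := fun t => mem_cusps t gK.
case: (cusps K) => //= a s csP s_sorted.
have leftE t : left_cusp K t = (0 < derive1 (derive1 (kx K)) t) by [].
pose f := derive1 (kx K).
have fE : f = 'D_1 (kx K) by apply/funext => t; rewrite /f derive1E.
have df x : derivable f x 1.
  by rewrite fE; apply/diff_derivable/(kx_smooth K [:: 1]).
have fp t : f (t + 1) = f t by apply/derive1_periodic/kx_periodic.
have [/andP[a_ge0 a_lt1] _] : is_cusp K a by apply/csP/mem_head.
have path_a : path <%R a (rcons s (a + 1)).
  rewrite rcons_path s_sorted /=.
  have [/andP[_ lt1] _] : is_cusp K (last a s) by apply/csP/mem_last.
  by rewrite (lt_le_trans lt1) // lerDr.
have simple t : t \in a :: s -> f t = 0 /\ derive1 f t != 0.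
  by move=> /csP ct; split; [case: ct|apply: (cusps_simple gK ct)].
rewrite -map_rcons path_map.
have : path (fun x y => (0 < derive1 f x) != (0 < derive1 f y)) a (rcons s (a + 1)).
  apply: zeros_alternate => // x.
  - rewrite -rcons_cons mem_rcons inE => /predU1P[->|/simple//].
    have [f0 df0] := simple a (mem_head _ _).
    by rewrite fp (derive1_periodic fp).
  - move=> /andP[ax xa] fx.
    have [x1|x1] := ltP x 1.
      have : x \in a :: s by apply/csP; split=> //; rewrite /in_period x1 (le_trans a_ge0 (ltW ax)).
      by rewrite inE (gt_eqF ax).
    (* A zero beyond 1 shifts back to a cusp before [a], which is the least cusp. *)
    have : x - 1 \in a :: s.
      apply/csP; split; last by rewrite -[derive1 _ _]/(f (x - 1)) -fp subrK.
      by apply/andP; split; lra.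
    rewrite inE => /predU1P[|x1s]; first by lra.
    by have := allP (order_path_min lt_trans s_sorted) _ x1s; lra.
rewrite !rcons_path (derive1_periodic fp a) => /andP[ps ls].
by apply/andP; split; [exact: ps|exact: ls].
Qed.

(** The order is strict because, without triple points, the understrand parameter determines the
    crossing. *)
Lemma under_params_sorted (R : realType) (K : legendrian_knot R) :
  generic_front K -> sorted <%R (map snd (crossings K)).
Proof.
move=> gK; have dpC s t : double_point K s t -> double_point K t s.
  by move=> [s1 t1 st xst zst]; split; rewrite // eq_sym.
have memP p : p \in crossings K -> double_point K p.2 p.1.
  rewrite /crossings mem_sort -[p \in _]/(p \in fset_set [set p | is_crossing K p]).
  rewrite in_fset_set; last exact: crossings_finite gK.
  by rewrite inE => -[/dpC].
rewrite lt_sorted_uniq_le map_inj_in_uniq ?sort_uniq ?fset_uniq /=.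
  by rewrite sorted_map sort_sorted // => p q; apply: le_total.
move=> [p1 p2] [q1 q2] /memP /= dp /memP /= dq /= pq2; rewrite -pq2 in dq *.
by rewrite (no_triple_points gK dp dq).
Qed.

(** This guarantees that the strict inequalities in [cusps_on_arc] lose no cusp. *)
Lemma under_param_not_cusp (R : realType) (K : legendrian_knot R) (i : nat) :
  generic_front K -> (i < nb_crossings K)%N -> under_param K i \notin cusps K.
Proof.
move=> gK ltin; apply/negP => /(mem_cusps _ gK).
apply: (crossings_off_cusps gK (t := (nth (0, 0) (crossings K) i).1)).
have := mem_nth (0, 0) ltin; set p := nth _ _ _.
rewrite /crossings mem_sort -[p \in _]/(p \in fset_set [set p | is_crossing K p]).
rewrite in_fset_set; last exact: crossings_finite gK.
by rewrite inE => -[[p1 p2 p12 xp zp] _]; split; rewrite // eq_sym.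
Qed.

Lemma under_param_lt (R : realType) (K : legendrian_knot R) (i j : nat) :
  generic_front K -> (i < j)%N -> (j < nb_crossings K)%N ->
  under_param K i < under_param K j.
Proof.
move=> gK ltij ltjn; have ltin := ltn_trans ltij ltjn.
have := sorted_ltn_nth lt_trans 0 (under_params_sorted gK) i j.
by rewrite !inE size_map !(nth_map (0, 0)) //; apply.
Qed.

(** The arcs tile the circle from the first undercrossing on; cusps before it come last, since the
    last arc runs through the base point. *)
Lemma cusps_on_arcs (R : realType) (K : legendrian_knot R) :
  generic_front K -> (0 < nb_crossings K)%N ->
  flatten [seq cusps_on_arc K i | i <- iota 0 (nb_crossings K)] =
  rot (count (< under_param K 0) (cusps K)) (cusps K).
Proof.
move=> gK n_gt0; have s_sorted := sub_sorted ltW (cusps_sorted K).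
(* Only arcs before the last one are concatenated here, so no wrap-around occurs yet. *)
have arcs k : (k < nb_crossings K)%N ->
    flatten [seq cusps_on_arc K i | i <- iota 0 k] =
    [seq t <- cusps K | under_param K 0 < t < under_param K k].
  elim: k => [_|k IHk ltkn].
    rewrite -[LHS](filter_pred0 (cusps K)); apply: eq_filter => t /=.
    by apply/esym/negP => /andP[/lt_trans/[apply]]; rewrite ltxx.
  rewrite -addn1 iotaD map_cat flatten_cat IHk ?(ltnW ltkn) //= cats0 add0n.
  rewrite addn1 /cusps_on_arc ltkn cat_filter_sorted //; last first.
    by move=> x y /andP[_ xk] /andP[ky _]; apply: lt_trans xk ky.
  apply: eq_in_filter => t tc; case: (ltgtP t (under_param K k)) => tk.
  - by rewrite andbT orbF (lt_trans tk (under_param_lt gK _ ltkn)) ?andbT.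
  - rewrite andbF /=; case: k {IHk} ltkn tk => [|k] ltkn tk; first by rewrite tk.
    by rewrite (lt_trans (under_param_lt gK _ (ltnW ltkn)) tk).
  - by have := under_param_not_cusp gK (ltnW ltkn); rewrite -tk tc.
case nE : (nb_crossings K) n_gt0 => [//|m] _.
rewrite -addn1 iotaD map_cat flatten_cat arcs ?nE //= cats0 add0n.
rewrite /cusps_on_arc nE ltnn catA cat_filter_sorted //; last first.
  by move=> x y /andP[_ xk] ky; apply: lt_trans xk ky.
(* The two blocks exchanged by the rotation are the cusps before and after the first
   undercrossing. *)
rewrite -[X in rot _ X](cat_take_drop (count (< under_param K 0) (cusps K))).
have sz : size (take (count (< under_param K 0) (cusps K)) (cusps K)) =
    count (< under_param K 0) (cusps K).
  by rewrite size_takel // count_size.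
rewrite -[X in rot X _]sz rot_size_cat -sorted_filter_lt // -sorted_filter_ge //.
congr cat; apply: eq_in_filter => t tc.
have n0 : t != under_param K 0.
  by apply: contraTneq tc => ->; apply: under_param_not_cusp; rewrite ?nE.
have nm : t != under_param K m.
  by apply: contraTneq tc => ->; apply: under_param_not_cusp; rewrite ?nE.
rewrite le_eqVlt eq_sym (negbTE n0) /=.
case: (ltgtP t (under_param K m)) nm => // tm _; first by rewrite andbT orbF.
rewrite andbF /=; case: m {arcs sz nE n0} (nE) tm => [|m] nE tm; first by rewrite tm.
by rewrite (lt_trans (under_param_lt gK _ _) tm) ?nE.
Qed.

(** * Colorings by permutation racks *)

(** The kink map of the permutation rack is [sigma], so [d_l] and [d_r] become the downward cases of
    [cusp_op]. *)
Lemma term_eval_pass_cusps (R : realType) (K : legendrian_knot R) (X : Type)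
    (sigma : permutation X) (u : leg4_structure (perm_rack sigma))
    (v : front_arc K -> X) (a : leg4_term (front_arc K)) (ts : seq R) :
  term_eval (A := Leg4Rack u) v (pass_cusps a ts) =
  foldl (cusp_op sigma (str_l u) (str_r u)) (term_eval (A := Leg4Rack u) v a)
    (map (cusp_type K) ts).
Proof.
elim: ts a => //= t ts IHts a; rewrite /pass_cusps /= -/(pass_cusps _ ts) IHts.
by congr foldl; rewrite /pass_cusp /cusp_type; case: up_cusp; case: left_cusp.
Qed.

Lemma term_eval_pass_under (R : realType) (K : legendrian_knot R) (X : Type)
    (sigma : permutation X) (u : leg4_structure (perm_rack sigma))
    (v : front_arc K -> X) (a : leg4_term (front_arc K)) (p : R * R) :
  term_eval (A := Leg4Rack u) v (pass_under a p) =
  zpow sigma (crossing_sign K p) (term_eval (A := Leg4Rack u) v a).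
Proof. by rewrite /pass_under /crossing_sign; case: positive_crossing. Qed.

(** The effect of one traversal in which the cusp of index [k] is met first, with all crossings
    gathered into one power of [sigma]. *)
Definition monodromy (R : realType) (K : legendrian_knot R) (X : Type)
    (sigma : permutation X) (u : leg4_structure (perm_rack sigma)) (k : nat)
    (x : X) : X :=
  zpow sigma (writhe K)
    (foldl (cusp_op sigma (str_l u) (str_r u)) x (map (cusp_type K) (rot k (cusps K)))).

Definition arc_transport (R : realType) (K : legendrian_knot R) (X : Type)
    (sigma : permutation X) (u : leg4_structure (perm_rack sigma)) (i : nat)
    (x : X) : X :=
  zpow sigma (crossing_sign K (nth (0, 0) (crossings K) (i.+1 %% nb_crossings K)))
    (foldl (cusp_op sigma (str_l u) (str_r u)) x (map (cusp_type K) (cusps_on_arc K i))).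

(** The color forced on arc [i] by the color [x] of arc 0. The index is not reduced, so at
    [nb_crossings K] this is the label on returning to arc 0. *)
Definition arc_color (R : realType) (K : legendrian_knot R) (X : Type)
    (sigma : permutation X) (u : leg4_structure (perm_rack sigma)) (x : X)
    (i : nat) : X :=
  iteri i (arc_transport K u) x.

Lemma arc_colorS (R : realType) (K : legendrian_knot R) (X : Type)
    (sigma : permutation X) (u : leg4_structure (perm_rack sigma)) (x : X)
    (i : nat) :
  arc_color K u x i.+1 = arc_transport K u i (arc_color K u x i).
Proof. by []. Qed.

Lemma str_l_comm (X : Type) (sigma : permutation X)
    (u : leg4_structure (perm_rack sigma)) (x : X) :
  str_l u (sigma x) = sigma (str_l u x).
Proof. exact: (proj1 (str_lU u) x x). Qed.

Lemma str_r_comm (X : Type) (sigma : permutation X)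
    (u : leg4_structure (perm_rack sigma)) (x : X) :
  str_r u (sigma x) = sigma (str_r u x).
Proof. exact: (proj1 (str_rU u) x x). Qed.

(** The powers of [sigma] commute past the cusps, so signs and cusps can be collected separately,
    arc by arc. *)
Lemma arc_color_total (R : realType) (K : legendrian_knot R) (X : Type)
    (sigma : permutation X) (u : leg4_structure (perm_rack sigma)) (x : X) :
  generic_front K -> (0 < nb_crossings K)%N ->
  arc_color K u x (nb_crossings K) =
  monodromy K u (count (< under_param K 0) (cusps K)) x.
Proof.
move=> gK n_gt0.
pose e i := crossing_sign K (nth (0, 0) (crossings K) (i.+1 %% nb_crossings K)).
have colorE k : arc_color K u x k = zpow sigma (\sum_(0 <= i < k) e i)
    (foldl (cusp_op sigma (str_l u) (str_r u)) x
      (map (cusp_type K) (flatten [seq cusps_on_arc K i | i <- iota 0 k]))).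
  elim: k => [|k IHk]; first by rewrite big_geq.
  rewrite arc_colorS /arc_transport IHk big_nat_recr //.
  have -> : iota 0 k.+1 = iota 0 k ++ [:: k] by rewrite -addn1 iotaD.
  rewrite map_cat flatten_cat /= cats0 map_cat foldl_cat.
  rewrite addrC zpowD; congr zpow.
  apply: (zpow_conj (f := fun y => foldl _ y (map (cusp_type K) (cusps_on_arc K k)))) => y.
  by apply: cusp_op_conj => z; [apply: str_l_comm|apply: str_r_comm].
rewrite colorE /monodromy -cusps_on_arcs //; congr zpow.
rewrite /e /writhe (big_nth (0, 0)) -/(nb_crossings K).
case: (nb_crossings K) n_gt0 => // m _.
(* Arc [i] ends at crossing [i + 1], so the last arc contributes the sign of crossing 0, which is
   moved to the front. *)
rewrite big_nat_recr // big_nat_recl //= modnn addrC; congr (_ + _).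
by apply: eq_big_nat => i /andP[_ im]; rewrite modn_small.
Qed.

(** All relations but the one ending at arc 0 propagate the color of arc 0 to the other arcs; that
    last relation says the color is fixed by the monodromy. *)
Lemma colorings_fixpoints (R : realType) (K : legendrian_knot R) (X : Type)
    (sigma : permutation X) (u : leg4_structure (perm_rack sigma)) :
  generic_front K -> exists k : nat,
  exists2 ev : leg4_hom (fundamental_rack K) (Leg4Rack u) -> X, injective ev &
    forall x, (exists h, ev h = x) <-> monodromy K u k x = x.
Proof.
move=> gK; have [n0|n_gt0] := posnP (nb_crossings K).
  (* Without crossings [front_arc K] has exactly one element. *)
  have arcE (g : front_arc K) : TGen g = arc_gen K 0.
    rewrite /arc_gen; congr TGen; apply/val_inj => /=.
    by case: g (inord _) => [i ?] [j ?] /=; lia.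
  exists 0; exists (fun h => h (pres_class _ (arc_gen K 0))).
    by move=> h k hk; apply: presented_hom_ext => g; rewrite arcE.
  have writhe0 : writhe K = 0 by rewrite /writhe (size0nil n0) big_nil.
  move=> x; rewrite /monodromy writhe0 rot0 /=; split=> [[h <-]|fx].
    have : front_rel (arc_gen K 0) (pass_cusps (arc_gen K 0) (cusps K)).
      by rewrite /front_rel n0 eqxx.
    move=> /Cong_rel/pres_class_cong/(congr1 h).
    by rewrite [h _ in RHS]hom_pres_class term_eval_pass_cusps => <-.
  have [|h hP] := @presented_lift _ (@front_rel R K) (Leg4Rack u) (fun=> x).
    move=> a b; rewrite /front_rel n0 eqxx => -[-> ->].
    by rewrite term_eval_pass_cusps.
  by exists h; apply: hP.
pose col (h : leg4_hom (fundamental_rack K) (Leg4Rack u)) i : X :=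
  h (pres_class _ (arc_gen K i)).
have colS h i : (i < nb_crossings K)%N ->
    col h (i.+1 %% nb_crossings K)%N = arc_transport K u i (col h i).
  move=> ltin; pose j := (i.+1 %% nb_crossings K)%N.
  have : front_rel (arc_gen K j)
      (pass_under (pass_cusps (arc_gen K i) (cusps_on_arc K i)) (nth (0, 0) (crossings K) j)).
    by rewrite /front_rel gtn_eqF //; exists i.
  move=> /Cong_rel/pres_class_cong/(congr1 h); rewrite [RHS]hom_pres_class.
  by rewrite term_eval_pass_under term_eval_pass_cusps.
have colE h i : (i < nb_crossings K)%N -> col h i = arc_color K u (col h 0%N) i.
  elim: i => // i IHi ltin.
  by rewrite arc_colorS -IHi ?(ltnW ltin) // -colS ?(ltnW ltin) // modn_small.
have arcsE (g : front_arc K) : arc_gen K g = TGen g.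
  by rewrite /arc_gen inord_val.
exists (count (< under_param K 0) (cusps K)); exists (col^~ 0%N).
  move=> h k hk; apply: presented_hom_ext => g.
  have ltgn : (g < nb_crossings K)%N by rewrite -[X in (_ < X)%N](prednK n_gt0).
  have : col h g = col k g by rewrite (colE h g) // (colE k g) // hk.
  by rewrite /col arcsE.
move=> x; rewrite -arc_color_total //; split=> [[h <-]|fx].
  have ltn : ((nb_crossings K).-1 < nb_crossings K)%N by rewrite prednK.
  rewrite -[X in arc_color _ _ _ X](prednK n_gt0) arc_colorS.
  by rewrite -colE // -colS // prednK // modnn.
pose v (g : front_arc K) := arc_color K u x g.
have vE i : (i < nb_crossings K)%N ->
    term_eval (A := Leg4Rack u) v (arc_gen K i) = arc_color K u x i.
  by move=> ltin; rewrite /= /v inordK // prednK.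
have [a b|h hP] := @presented_lift _ (@front_rel R K) (Leg4Rack u) v.
  rewrite /front_rel gtn_eqF // => -[i ltin [-> ->]].
  rewrite term_eval_pass_under term_eval_pass_cusps !vE ?ltn_pmod //.
  rewrite -[RHS]arc_colorS.
  (* The relation returning to arc 0 is the fixed-point equation; the others hold by construction of
     [v]. *)
  have [ltin1|] := ltnP i.+1 (nb_crossings K); first by rewrite modn_small.
  move=> lein1; have -> : i.+1 = nb_crossings K by apply/eqP; rewrite eqn_leq ltin.
  by rewrite modnn fx.
by exists h; rewrite /col hP /v inordK // prednK.
Qed.

(** * Comparison of the monodromies of two knots *)

(** Rotating the cusp word preserves cyclic alternation and both counts, so the starting point can
    affect only the order of the two factors. *)
Lemma monodromy_normal_form (R : realType) (K : legendrian_knot R) (X : Type)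
    (sigma : permutation X) (u : leg4_structure (perm_rack sigma)) (k : nat) :
  generic_front K ->
  exists2 z : int, (nb_up K)%:Z - (nb_down K)%:Z = z *+ 2 &
    (forall x, monodromy K u k x = zpow sigma (writhe K - (nb_down K)%:Z)
       (zpow (perm_comp (str_l u) (str_r u)) z x)) \/
    (forall x, monodromy K u k x = zpow sigma (writhe K - (nb_down K)%:Z)
       (zpow (perm_comp (str_r u) (str_l u)) z x)).
Proof.
move=> gK; set w := map (cusp_type K) (rot k (cusps K)).
have wC : path.cycle alternate w by rewrite /w map_rot rot_cycle cusps_alternate.
have [z] := cusp_word_cyclic (@str_l_comm _ _ u) (@str_r_comm _ _ u) wC.
have -> : count fst w = nb_up K.
  by rewrite /w count_map /nb_up; apply/permP; rewrite perm_rot.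
have -> : count (predC fst) w = nb_down K.
  by rewrite /w count_map /nb_down; apply/permP; rewrite perm_rot.
move=> zE wE; exists z => //.
by case: wE => wE; [left|right] => x; rewrite /monodromy wE -zpowD.
Qed.

(** The two integers are tb - rot and - 2 rot. *)
Lemma classical_invariants_word (R : realType) (K1 K2 : legendrian_knot R) :
  thurston_bennequin K1 = thurston_bennequin K2 ->
  rotation_number K1 = rotation_number K2 ->
  writhe K1 - (nb_down K1)%:Z = writhe K2 - (nb_down K2)%:Z /\
  (nb_up K1)%:Z - (nb_down K1)%:Z = (nb_up K2)%:Z - (nb_down K2)%:Z.
Proof.
rewrite /thurston_bennequin /rotation_number !natrD => tb rot.
split; apply: (@intr_inj rat); rewrite !rmorphB /= -!pmulrn; lra.
Qed.

Theorem theorem1p1 (R : realType) (L1 L2 K1 K2 : legendrian_knot R)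
    (front1 : front_of L1 K1) (front2 : front_of L2 K2)
    (same_tb : thurston_bennequin K1 = thurston_bennequin K2) 
    (same_rot : rotation_number K1 = rotation_number K2)
    (X : Type) (sigma : permutation X)
    (u : leg4_structure (perm_rack sigma)) :
  exists f : leg4_hom (fundamental_rack K1) (Leg4Rack u) ->
             leg4_hom (fundamental_rack K2) (Leg4Rack u),
    bijective f.
Proof.
have [_ g1] := front1; have [_ g2] := front2.
have [wE rE] := classical_invariants_word same_tb same_rot.
have [k1 [ev1 ev1_inj ev1P]] := colorings_fixpoints u g1.
have [k2 [ev2 ev2_inj ev2P]] := colorings_fixpoints u g2.
have [z1 z1E M1] := monodromy_normal_form u k1 g1.
have [z2 z2E M2] := monodromy_normal_form u k2 g2.
have zE : z1 = z2 by move: rE; rewrite z1E z2E; lia.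
subst z2; rewrite -{}wE in M2.
have ev1E h : monodromy K1 u k1 (ev1 h) = ev1 h by apply/ev1P; exists h.
have ev2E h : monodromy K2 u k2 (ev2 h) = ev2 h by apply/ev2P; exists h.
(* A permutation intertwining the two monodromies carries the fixed points of one onto those of the
   other. *)
suff [phi phiE] : exists phi : permutation X,
    forall x, phi (monodromy K1 u k1 x) = monodromy K2 u k2 (phi x).
  apply: (bijection_of_images (phi := phi) (psi := pinv phi) ev1_inj ev2_inj).
  - by move=> h; apply/ev2P; rewrite -phiE ev1E.
  - move=> h; apply/ev1P; apply: (can_inj (pfunK phi)).
    by rewrite phiE !pinvK ev2E.
  - by move=> h; rewrite pfunK.
  - by move=> h; rewrite pinvK.
pose idp := @Permutation X id id (fun=> erefl) (fun=> erefl).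
have lC := @str_l_comm _ _ u; have rC := @str_r_comm _ _ u.
case: M1 M2 => M1 [] M2.
- by exists idp => x; rewrite /= M1 M2.
(* [u_r] commutes with [sigma] and conjugates [u_l u_r] to [u_r u_l]; in the opposite case [u_l]
   plays this part. *)
- exists (str_r u) => x; rewrite M1 M2 (zpow_conj rC); congr zpow.
  exact: zpow_conj.
- exists (str_l u) => x; rewrite M1 M2 (zpow_conj lC); congr zpow.
  exact: zpow_conj.
- by exists idp => x; rewrite /= M1 M2.
Qed.
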